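(* Let $\sigma$ be a full-rank density matrix on $\mathbb{C}^d$, not a multiple of the identity, and let $\mathcal{L}$ be a purely irreversible Lindbladian on $\mathbb{C}^{d\times d}$ that is detailed balanced with respect to $\sigma$, written in canonical form with data $w_\alpha,G^\alpha,X^\alpha(\omega)$. Then the quantum discriminate $\mathcal{Q}^f$ of $\mathcal{L}$ is independent of the function $f:(0,\infty)\to(0,\infty)$. It acts as $\mathcal{Q}=I+\mathcal{K}$, where for all $A\in\mathbb{C}^{d\times d}$ $$\mathcal{K}(A)=\sum_\alpha w_\alpha\sum_\omega\left[\sqrt{G^\alpha(\omega)G^\alpha(-\omega)}\;X^\alpha(\omega)AX^{\alpha\dagger}(\omega)-\frac{G^\alpha(\omega)}{2}\big\{X^{\alpha\dagger}(\omega)X^\alpha(\omega),A\big\}\right].$$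
   Context: A purely irreversible Lindbladian (Schrödinger picture) has the form $\mathcal{L}(\rho)=\sum_iL_i\rho L_i^\dagger-\frac12\{L_i^\dagger L_i,\rho\}$; $\mathcal{L}^*$ is its adjoint for the Hilbert–Schmidt inner product $\langle X,Y\rangle=\mathrm{Tr}(X^\dagger Y)$. $\mathcal{L}$ is detailed balanced with respect to $\sigma$ if $\mathcal{L}^*$ is hermitian with respect to the GNS inner product $\langle A,B\rangle_1=\mathrm{Tr}(A^\dagger B\sigma)$. Modular operator and $\Omega_\sigma^f$. $\Delta_\sigma(A)=\sigma A\sigma^{-1}$, a positive definite superoperator for the Hilbert–Schmidt inner product. For $f:(0,\infty)\to(0,\infty)$, $\Omega^f_\sigma=R_\sigma\circ f(\Delta_\sigma)$, where $f(\Delta_\sigma)$ is given by functional calculus and $R_\sigma(A)=A\sigma$. $\Omega^f_\sigma$ is positive definite. Quantum discriminate. $\mathcal{Q}^f=I+\mathcal{K}^f$ with $\mathcal{K}^f=[\Omega_\sigma^f]^{-1/2}\circ\mathcal{L}\circ[\Omega_\sigma^f]^{1/2}$, which for detailed balanced $\mathcal{L}$ equals $[\Omega_\sigma^f]^{1/2}\circ\mathcal{L}^*\circ[\Omega_\sigma^f]^{-1/2}$. Bohr frequencies. Write $h=-\ln\sigma=\sum_k\varepsilon_kP_k$ with distinct eigenvalues $\varepsilon_k$; the Bohr frequencies are the numbers $\varepsilon_k-\varepsilon_\ell$. Canonical form. $\mathcal{L}=\sum_\alpha w_\alpha\mathcal{L}^\alpha$ is a finite convex combination ($w_\alpha\ge0$,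 $\sum_\alpha w_\alpha=1$) with $$\mathcal{L}^\alpha(\rho)=\sum_\omega G^\alpha(\omega)\Big(X^\alpha(\omega)\rho X^{\alpha\dagger}(\omega)-\tfrac12\{X^{\alpha\dagger}(\omega)X^\alpha(\omega),\rho\}\Big),$$ where $\omega$ runs over all distinct Bohr frequencies of $h$ and $X^\alpha(\omega)=X^{\alpha\dagger}(-\omega)$, $\Delta_\sigma X^\alpha(\omega)=e^{-\omega}X^\alpha(\omega)$, $G^\alpha(\omega)\ge0$, $G^\alpha(\omega)=e^{-\omega}G^\alpha(-\omega)$. *)

(* Defs.v *)
(* Complex numbers are [R[i]] for [R : realType]; superoperators are functions
   ['M[R[i]]_d -> 'M[R[i]]_d]. *)
From HB Require Import structures.
From mathcomp Require Import all_boot all_order all_algebra.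
From mathcomp Require Import complex.
From mathcomp Require Import reals sequences exp.

Set Implicit Arguments.
Unset Strict Implicit.
Unset Printing Implicit Defensive.

Import Order.TTheory GRing.Theory Num.Theory.
Open Scope ring_scope.
Open Scope complex_scope.
Open Scope sesquilinear_scope.

Section FunctionalCalculus.
Context {R : realType}.
Local Notation C := R[i].

(* [f(A) = U^* diag (f(a_i)) U] where [A = U^* diag(a_i) U] is the unitary
   diagonalization of [A]; meaningful for hermitian [A], whose [a_i] are
   real. *)
Definition hermfun (f : R -> R) n (A : 'M[C]_n) : 'M[C]_n :=
  invmx (spectralmx A)
    *m diag_mx (map_mx (fun z : C => (f (complex.Re z))%:C) (spectral_diag A))
    *m spectralmx A.

Definition spectrum n (A : 'M[C]_n) : seq R :=
  undup [seq complex.Re (spectral_diag A 0 i) | i : 'I_n].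

(* [mxvec] is an isometry from the Hilbert-Schmidt inner product to the
   standard one, so [lin_mx Phi] is the matrix of [Phi] (acting on row
   vectors) in an orthonormal basis. *)
Definition sop_of_mx d (M : 'M[C]_(d * d)) (A : 'M[C]_d) : 'M[C]_d :=
  vec_mx (mxvec A *m M).

Definition sopfun (f : R -> R) d (Phi : 'M[C]_d -> 'M[C]_d) :
    'M[C]_d -> 'M[C]_d :=
  sop_of_mx (hermfun f (lin_mx Phi)).

Definition hs_adjoint d (Phi : 'M[C]_d -> 'M[C]_d) : 'M[C]_d -> 'M[C]_d :=
  sop_of_mx ((lin_mx Phi)^t*).

End FunctionalCalculus.

Section Lindblad.
Context {R : realType} {d : nat}.
Local Notation C := R[i].
Local Notation M := 'M[C]_d.
Implicit Types (sigma A B X rho : M) (L : M -> M) (f : R -> R).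

Definition hs_inner A B : C := \tr (A^t* *m B).

Definition gns_inner sigma A B : C := \tr (A^t* *m B *m sigma).

Definition density_matrix sigma : Prop :=
  [/\ sigma \is hermsymmx,
      forall v : 'cV[C]_d, 0 <= (v^t* *m sigma *m v) 0 0
    & \tr sigma = 1].

Definition anticomm A B : M := A *m B + B *m A.

Definition dissipator X rho : M :=
  X *m rho *m X^t* - 2^-1 *: anticomm (X^t* *m X) rho.

Definition purely_irreversible_lindbladian L : Prop :=
  exists (n : nat) (Ls : 'I_n -> M),
    forall rho, L rho = \sum_(i < n) dissipator (Ls i) rho.

Definition detailed_balanced sigma L : Prop :=
  forall A B,
    gns_inner sigma A (hs_adjoint L B) = gns_inner sigma (hs_adjoint L A) B.

Definition modular sigma A : M := sigma *m A *m invmx sigma.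

Definition rmul sigma A : M := A *m sigma.

Definition Omega f sigma : M -> M := rmul sigma \o sopfun f (modular sigma).

Definition discriminate_K f sigma L : M -> M :=
  sopfun (fun x => (Num.sqrt x)^-1) (Omega f sigma)
    \o L \o sopfun Num.sqrt (Omega f sigma).

Definition discriminate f sigma L A : M := A + discriminate_K f sigma L A.

Definition bohr_frequencies sigma : seq R :=
  let h := hermfun (fun x => - ln x) sigma in
  undup [seq x - y | x <- spectrum h, y <- spectrum h].

Record lindblad_canonical_form sigma L (I : finType)
    (w : I -> R) (G : I -> R -> R) (X : I -> R -> M) : Prop := {
  canonical_w_ge0 : forall a, 0 <= w a;
  canonical_w_sum : \sum_a w a = 1;
  canonical_X_adj : forall a om, om \in bohr_frequencies sigma ->
    X a om = (X a (- om))^t*;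
  canonical_X_modular : forall a om, om \in bohr_frequencies sigma ->
    modular sigma (X a om) = (expR (- om))%:C *: X a om;
  canonical_G_ge0 : forall a om, om \in bohr_frequencies sigma -> 0 <= G a om;
  canonical_G_kms : forall a om, om \in bohr_frequencies sigma ->
    G a om = expR (- om) * G a (- om);
  canonical_eq : forall rho, L rho =
    \sum_a (w a)%:C *: \sum_(om <- bohr_frequencies sigma)
      (G a om)%:C *: dissipator (X a om) rho
}.

End Lindblad.

Section Validation.
Context {R : realType}.
Local Notation C := R[i].

Lemma hs_adjointP d (Phi : {linear 'M[C]_d -> 'M[C]_d}) (X Y : 'M[C]_d) :
  hs_inner X (hs_adjoint Phi Y) = hs_inner (Phi X) Y.
Proof.
have innerE (A B : 'M[C]_d) :
    hs_inner A B = (mxvec B *m (mxvec A)^t*) 0 0.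
  rewrite /hs_inner mxE (reindex _ (curry_mxvec_bij d d)) /=.
  rewrite /mxtrace (eq_bigr (fun j : 'I_d => \sum_i B i j * (A i j)^*%R)).
    rewrite exchange_big pair_bigA; apply: eq_bigr => -[i j] _ /=.
    by rewrite mxvecE 2!mxE mxvecE.
  by move=> j _; rewrite mxE; apply: eq_bigr => i _; rewrite !mxE mulrC.
rewrite !innerE /hs_adjoint /sop_of_mx vec_mxK -mul_vec_lin.
by rewrite trmx_mul map_mxM mulmxA.
Qed.

Lemma hermfun_eigen (f : R -> R) n (A : 'M[C]_n) (v : 'rV[C]_n) (a : R) :
  A \is hermsymmx -> v *m A = a%:C *: v ->
  v *m hermfun f A = (f a)%:C *: v.
Proof.
move=> /hermitian_normalmx /orthomx_spectralP AE vA.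
have PU := spectral_unit A.
rewrite /hermfun; set P := spectralmx A in AE PU *.
set D := spectral_diag A in AE *.
have uD : v *m invmx P *m diag_mx D = a%:C *: (v *m invmx P).
  by rewrite scalemxAl -vA {1}AE !mulmxA mulmxK.
set u := v *m invmx P in uD *.
have -> : v = u *m P by rewrite mulmxKV.
move: u uD => u uD; rewrite !mulmxA mulmxK // scalemxAl; congr (_ *m P).
apply/rowP => i; move/rowP/(_ i): uD.
rewrite !mul_mx_diag !mxE => uDi.
case: (eqVneq (u 0 i) 0) => [u0|u0]; first by rewrite u0 mul0r mulr0.
move: uDi; rewrite mulrC => /(mulIf u0) ->.
by rewrite mulrC.
Qed.

Lemma mem_spectrum n (A : 'M[C]_n) (a : R) :
  A \is hermsymmx -> (a \in spectrum A) = eigenvalue A a%:C.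
Proof.
move=> Ah; have PU := spectral_unit A.
have AE := orthomx_spectralP (hermitian_normalmx Ah).
have Dreal := hermitian_spectral_diag_real Ah.
set P := spectralmx A in AE PU; set D := spectral_diag A in AE Dreal.
have DE i : D 0 i = (complex.Re (D 0 i))%:C.
  have /mxOverP/(_ 0 i) := Dreal.
  by move/complex_realP => [x ->].
rewrite mem_undup; apply/codomP/eigenvalueP => [[i ->]|[v vA v0]].
  have PA : P *m A = diag_mx D *m P by rewrite {1}AE !mulmxA mulmxV // mul1mx.
  exists (row i P).
    by rewrite -row_mul PA -DE; apply/rowP => j; rewrite mul_diag_mx !mxE.
  apply/negP => /eqP; rewrite rowE => /(congr1 (mulmx^~ (invmx P))).
  rewrite mulmxK // mul0mx => /rowP/(_ i); rewrite !mxE !eqxx => /eqP.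
  by rewrite oner_eq0.
have uD : v *m invmx P *m diag_mx D = a%:C *: (v *m invmx P).
  by rewrite scalemxAl -vA {1}AE !mulmxA mulmxK.
have /rV0Pn[i ui] : v *m invmx P != 0.
  apply: contraNneq v0 => /(congr1 (mulmx^~ P)).
  by rewrite mulmxKV // mul0mx => ->.
exists i; move/rowP/(_ i): uD; rewrite mul_mx_diag mxE [RHS]mxE mulrC.
by move/(mulIf ui) => ->.
Qed.

End Validation.

(* Main.v *)
(* Diagonalize sigma = U^-1 diag(s) U.  In the matrix units
   E_ij = U^-1 delta_ij U, the modular operator, Omega and every function of
   them are diagonal; Omega^f has the eigenvalue m_ij = f(s_i/s_j) s_j on E_ij.
   The relation Delta_sigma X = e^-w X says that X maps index k to index i only
   when s_i = e^-w s_k, so X A X^* moves the component E_kl to some E_ij with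
   s_i/s_j = s_k/s_l and m_ij = e^-w m_kl: the conjugation by Omega^(1/2)
   multiplies the jump term by e^(w/2), whatever f is, and
   G(w) e^(w/2) = sqrt(G(w) G(-w)).  Likewise X^* X only connects indices with
   equal s_i, so the anticommutator term is unchanged. *)
Require Import Defs.
From HB Require Import structures.
From mathcomp Require Import all_boot all_order all_algebra.
From mathcomp Require Import complex.
From mathcomp Require Import reals sequences exp.

Set Implicit Arguments.
Unset Strict Implicit.
Unset Printing Implicit Defensive.

Import Order.TTheory GRing.Theory Num.Theory.

(* Locked, because [mxE] would otherwise see through both definitions. *)
HB.lock Definition basis_change (R : realType) (d : nat) (U A : 'M[R[i]]_d) :
    'M[R[i]]_d :=
  U *m A *m invmx U.

HB.lock Definition schur (R : realType) (d : nat) (U : 'M[R[i]]_d)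
    (c : 'I_d -> 'I_d -> R) (A : 'M[R[i]]_d) : 'M[R[i]]_d :=
  invmx U *m (\matrix_(i, j) ((c i j)%:C * basis_change U A i j)) *m U.

(** * Superoperators that multiply matrix entries in a fixed basis *)

Section SchurMultiplier.
Context {R : realType} {d : nat} (U : 'M[R[i]]_d).
Implicit Types (c : 'I_d -> 'I_d -> R) (A B X Z : 'M[R[i]]_d).
Local Notation basis_change := (basis_change U).
Local Notation schur := (schur U).

Fact basis_change_is_linear : linear basis_change.
Proof.
move=> k A B; rewrite basis_change.unlock mulmxDr mulmxDl.
by rewrite -scalemxAr -scalemxAl.
Qed.
HB.instance Definition _ :=
  GRing.isLinear.Build _ _ _ _ basis_change basis_change_is_linear.

Fact schur_is_linear c : linear (schur c).
Proof.
move=> k A B; rewrite schur.unlock scalemxAl scalemxAr -mulmxDl -mulmxDr.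
congr (_ *m _ *m _); apply/matrixP => i j.
by rewrite linearP !mxE mulrDr mulrCA.
Qed.
HB.instance Definition _ c :=
  GRing.isLinear.Build _ _ _ _ (schur c) (schur_is_linear c).

Lemma basis_changeZ k A : basis_change (k *: A) = k *: basis_change A.
Proof. exact: linearZ_LR. Qed.

Section Invertible.
Hypothesis Uu : U \in unitmx.

Lemma basis_changeK A : invmx U *m basis_change A *m U = A.
Proof. by rewrite basis_change.unlock -(mulmxA U) mulKmx // mulmxKV. Qed.

Lemma basis_changeVK A : basis_change (invmx U *m A *m U) = A.
Proof. by rewrite basis_change.unlock -(mulmxA _ A) mulKVmx // mulmxK. Qed.

Lemma basis_change_inj : injective basis_change.
Proof. by move=> A B AB; rewrite -(basis_changeK A) AB basis_changeK. Qed.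

Lemma basis_changeM A B :
  basis_change (A *m B) = basis_change A *m basis_change B.
Proof. by rewrite basis_change.unlock !mulmxA (mulmxKV Uu (U *m A)). Qed.

Lemma basis_change_schur c A i j :
  basis_change (schur c A) i j = (c i j)%:C * basis_change A i j.
Proof. by rewrite schur.unlock basis_changeVK mxE. Qed.

(** In the basis [U], entry [(i, j)] of the left side sums [X i k * A k l * Z l j] with weight
    [b i j * a k l], so the weight matters only where [X i k] and [Z l j] are nonzero. *)
Lemma schur_mulmx (a b : 'I_d -> 'I_d -> R) (e : R) X Z A :
    (forall i k l j, basis_change X i k != 0 -> basis_change Z l j != 0 ->
       b i j * a k l = e) ->
  schur b (X *m schur a A *m Z) = e%:C *: (X *m A *m Z).
Proof.
move=> abe; apply: basis_change_inj; apply/matrixP => i j.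
have mulE (X' A' Z' : 'M[R[i]]_d) : (X' *m A' *m Z') i j =
    \sum_l \sum_k X' i k * A' k l * Z' l j.
  by rewrite mxE; apply: eq_bigr => l _; rewrite mxE mulr_suml.
rewrite basis_change_schur basis_changeZ !basis_changeM mulE [RHS]mxE mulE !mulr_sumr.
apply: eq_bigr => l _; rewrite !mulr_sumr; apply: eq_bigr => k _.
rewrite basis_change_schur.
have [->|X0] := eqVneq (basis_change X i k) 0; first by rewrite !mul0r !mulr0.
have [->|Z0] := eqVneq (basis_change Z l j) 0; first by rewrite !mulr0.
rewrite -(abe _ _ _ _ X0 Z0) [in RHS]rmorphM /= -!mulrA; congr (_ * _).
by rewrite mulrCA.
Qed.

Lemma schur_delta c i j :
  schur c (invmx U *m delta_mx i j *m U) =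
  (c i j)%:C *: (invmx U *m delta_mx i j *m U).
Proof.
apply: basis_change_inj; apply/matrixP => k l.
rewrite basis_change_schur basis_changeZ basis_changeVK !mxE.
by have [/andP[/eqP-> /eqP->]//|] := boolP (_ && _); rewrite !mulr0.
Qed.

Lemma basis_change_sum A :
  A = \sum_i \sum_j basis_change A i j *: (invmx U *m delta_mx i j *m U).
Proof.
rewrite -{1}(basis_changeK A) {1}[basis_change A]matrix_sum_delta.
rewrite mulmx_sumr mulmx_suml; apply: eq_bigr => i _.
rewrite mulmx_sumr mulmx_suml; apply: eq_bigr => j _.
by rewrite -scalemxAr -scalemxAl.
Qed.
End Invertible.

(** * Functional calculus under a unitary change of basis *)

Hypothesis U_unitary : U \is unitarymx.
Let Uu : U \in unitmx := unitarymx_unit U_unitary.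

Lemma basis_change_adj A : basis_change (A^t*) = (basis_change A)^t*.
Proof.
rewrite basis_change.unlock invmx_unitary // !trmx_mul !map_mxM /=.
by rewrite map_trmx trmxK map_mxCK mulmxA.
Qed.

Lemma hs_inner_basis_change A B :
  hs_inner A B = \sum_i \sum_j (basis_change A i j)^*%R * basis_change B i j.
Proof.
have -> : hs_inner A B = \tr (basis_change (A^t* *m B)).
  by rewrite basis_change.unlock mxtrace_mulC mulKmx.
rewrite basis_changeM // basis_change_adj exchange_big /=.
by apply: eq_bigr => j _; rewrite mxE; apply: eq_bigr => i _; rewrite !mxE.
Qed.

Lemma hs_inner_schur c A B : hs_inner A (schur c B) = hs_inner (schur c A) B.
Proof.
rewrite !hs_inner_basis_change; apply: eq_bigr => i _; apply: eq_bigr => j _.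
rewrite !basis_change_schur // rmorphM /= mulrA; congr (_ * _).
rewrite mulrC; congr (_ * _).
by rewrite conj_Creal //; apply/complex_realP; exists (c i j).
Qed.

(** Real multipliers are self-adjoint for the Hilbert-Schmidt product; this lets [hermfun_eigen]
    apply to [lin_mx (schur c)]. *)
Lemma lin_mx_schur_herm c : lin_mx (schur c) \is hermsymmx.
Proof.
apply/is_hermitianmxP; rewrite expr0 scale1r.
apply/row_matrixP => i; rewrite !rowE -[delta_mx _ _]vec_mxK.
apply: (can_inj vec_mxK); set Y := vec_mx (delta_mx _ _).
apply/matrixP => k l.
(* Pairing with a matrix unit reads off one entry, which reduces the claim to the adjoint
   relation. *)
have innerE V : hs_inner (delta_mx k l) V = V k l.
  rewrite /hs_inner /mxtrace (bigD1 l) //= big1 ?addr0 => [|j jl].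
    rewrite mxE (bigD1 k) //= big1 ?addr0 => [|j jk].
      by rewrite !mxE !eqxx /= rmorph1 mul1r.
    by rewrite !mxE (negPf jk) /= rmorph0 mul0r.
  by rewrite mxE big1 // => j' _; rewrite !mxE (negPf jl) andbF rmorph0 mul0r.
rewrite -[LHS]innerE -[RHS]innerE mx_vec_lin hs_inner_schur.
by rewrite -hs_adjointP.
Qed.

(** The units [E_ij] span the space and are eigenvectors of [schur c], so [hermfun_eigen] evaluates
    the calculus on each of them, whatever eigenbasis [spectralmx] picks. *)
Lemma sopfun_schur (g : R -> R) c Phi :
  Phi =1 schur c -> sopfun g Phi =1 schur (fun i j => g (c i j)).
Proof.
move=> PhiE A; rewrite /sopfun.
(* [Phi] is a bare function, whereas [schur c] carries a linear structure. *)
have -> : lin_mx Phi = lin_mx (schur c).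
  by apply/matrixP => i j; rewrite !mxE /= PhiE.
rewrite [RHS](basis_change_sum Uu) {1}(basis_change_sum Uu A) /sop_of_mx.
rewrite !(linear_sum, mulmx_suml); apply: eq_bigr => i _.
rewrite !(linear_sum, mulmx_suml); apply: eq_bigr => j _.
rewrite !linearZ_LR -scalemxAl linearZ_LR basis_change_schur //= mulrC -scalerA.
rewrite (hermfun_eigen g (a := c i j)) ?lin_mx_schur_herm //.
  by rewrite linearZ_LR /= mxvecK.
by rewrite mul_vec_lin /= schur_delta // linearZ_LR.
Qed.

End SchurMultiplier.

(** * The modular operator and [Omega] in an eigenbasis of [sigma] *)

Section Discriminate.
Context {R : realType} {d : nat}.
Implicit Types (sigma A X : 'M[R[i]]_d) (f : R -> R) (e : R).

Lemma density_diag sigma : density_matrix sigma -> sigma \in unitmx ->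
  exists U : 'M[R[i]]_d, exists s : 'I_d -> R,
    [/\ U \is unitarymx, forall i, 0 < s i
      & basis_change U sigma = diag_mx (\row_i (s i)%:C)].
Proof.
move=> [sigma_herm sigma_ge0 _] sigma_unit; set U := spectralmx sigma.
have U_unitary : U \is unitarymx := spectral_unitarymx sigma.
have Uu := unitarymx_unit U_unitary.
have DE : basis_change U sigma = diag_mx (spectral_diag sigma).
  rewrite {1}(orthomx_spectralP (hermitian_normalmx sigma_herm)).
  exact: basis_changeVK.
have D_ge0 i : 0 <= spectral_diag sigma 0 i.
  (* For this vector the quadratic form is the [i]-th diagonal entry of [U sigma U^-1], an
     eigenvalue. *)
  have := sigma_ge0 ((row i U)^t*); rewrite map_trmx trmxK map_mxCK -row_mul.
  rewrite (_ : _ 0 0 = basis_change U sigma i i).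
    by rewrite DE mxE eqxx mulr1n.
  rewrite basis_change.unlock invmx_unitary // [RHS]mxE mxE.
  by apply: eq_bigr => j _; rewrite [row _ _ _ _]mxE !mxE.
have D_neq0 i : spectral_diag sigma 0 i != 0.
  have : \det (basis_change U sigma) != 0.
    rewrite basis_change.unlock -unitfE -unitmxE.
    by rewrite !unitmx_mul Uu sigma_unit unitmx_inv Uu.
  by rewrite DE det_diag => /prodf_neq0/(_ i isT).
exists U, (fun i => complex.Re (spectral_diag sigma 0 i)).
have DR i : spectral_diag sigma 0 i = (complex.Re (spectral_diag sigma 0 i))%:C.
  by have /complex_realP[x ->] := ger0_real (D_ge0 i).
split=> // [i|]; last first.
  by rewrite DE; congr diag_mx; apply/rowP => i; rewrite mxE.
by rewrite -ltcR -DR lt_def D_neq0 D_ge0.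
Qed.

Section Diagonal.
Variables (U sigma : 'M[R[i]]_d) (s : 'I_d -> R).
Hypotheses (U_unitary : U \is unitarymx) (s_gt0 : forall i, 0 < s i).
Hypothesis sigma_unit : sigma \in unitmx.
Hypothesis sigmaE : basis_change U sigma = diag_mx (\row_i (s i)%:C).
Let Uu : U \in unitmx := unitarymx_unit U_unitary.
Let s_neq0 i : s i != 0. Proof. by rewrite gt_eqF. Qed.

Lemma modular_schur : modular sigma =1 schur U (fun i j => s i / s j).
Proof.
move=> A; rewrite /modular.
suff -> : sigma *m A = schur U (fun i j => s i / s j) A *m sigma.
  by rewrite mulmxK.
apply: (basis_change_inj Uu); rewrite !basis_changeM // sigmaE.
rewrite mul_diag_mx mul_mx_diag; apply/matrixP => i j; rewrite 4!mxE.
rewrite basis_change_schur // mulrAC -rmorphM /=.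
by rewrite divfK.
Qed.

Lemma Omega_schur f :
  Omega f sigma =1 schur U (fun i j => f (s i / s j) * s j).
Proof.
move=> A; rewrite /Omega /rmul /= (sopfun_schur U_unitary f modular_schur).
apply: (basis_change_inj Uu); rewrite basis_changeM // sigmaE mul_mx_diag.
apply/matrixP => i j; rewrite 2!mxE !basis_change_schur // rmorphM /=.
by rewrite mulrAC.
Qed.

Lemma modular_eigen_support X e i j :
  modular sigma X = e%:C *: X -> basis_change U X i j != 0 -> s i = e * s j.
Proof.
move=> XE Xij; have := congr1 (fun B => basis_change U B i j) XE.
rewrite /= modular_schur basis_change_schur // basis_changeZ mxE.
by move=> /(mulIf Xij)/complexI <-; rewrite divfK.
Qed.

(** * Conjugation of the jump and anticommutator terms *)

Variable f : R -> R.
Hypothesis f_gt0 : forall x, 0 < x -> 0 < f x.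
(** Eigenvalues on [E_ij] of [Omega f sigma], of its inverse square root and of its square root. *)
Let m i j := f (s i / s j) * s j.
Let b i j := (Num.sqrt (m i j))^-1.
Let a i j := Num.sqrt (m i j).
Let m_gt0 i j : 0 < m i j.
Proof. by rewrite mulr_gt0 // f_gt0 // divr_gt0. Qed.

Lemma discriminate_K_schur L A :
  discriminate_K f sigma L A = schur U b (L (schur U a A)).
Proof.
rewrite /discriminate_K /= (sopfun_schur U_unitary _ (Omega_schur f)).
by rewrite (sopfun_schur U_unitary _ (Omega_schur f)).
Qed.

Lemma schur_jump X e A : 0 < e -> modular sigma X = e%:C *: X ->
  schur U b (X *m schur U a A *m X^t*) =
  ((Num.sqrt e)^-1)%:C *: (X *m A *m X^t*).
Proof.
move=> e_gt0 XE; apply: (schur_mulmx Uu) => i k l j Xik.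
rewrite basis_change_adj // 2!mxE fmorph_eq0 => Xjl.
have sik := modular_eigen_support XE Xik.
have sjl := modular_eigen_support XE Xjl.
(* Since [s i = e * s k] and [s j = e * s l], the factor [e] cancels in the argument of [f] and
   survives only in the factor [s j]. *)
have -> : b i j = (Num.sqrt (e * m k l))^-1.
  rewrite /b /m sik sjl invfM mulrACA divff ?gt_eqF // mul1r.
  by rewrite mulrCA.
rewrite sqrtrM ?ltW // invfM mulfVK //.
by rewrite gt_eqF // sqrtr_gt0.
Qed.

Lemma schur_anticomm X e A : 0 < e -> modular sigma X = e%:C *: X ->
  schur U b (anticomm (X^t* *m X) (schur U a A)) = anticomm (X^t* *m X) A.
Proof.
move=> e_gt0 XE; rewrite /anticomm; set N := X^t* *m X.
(* A nonzero entry of [N] needs some [k] with [X k i] and [X k j] both nonzero, whence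
   [e * s i = s k = e * s j]. *)
have sN i j : basis_change U N i j != 0 -> s i = s j.
  apply: contraNeq => sij; rewrite basis_changeM // basis_change_adj //.
  rewrite mxE big1 // => k _; rewrite 2!mxE.
  have [->|Xki] := eqVneq (basis_change U X k i) 0.
    by rewrite rmorph0 mul0r.
  have [->|Xkj] := eqVneq (basis_change U X k j) 0; first by rewrite mulr0.
  move: sij; rewrite -(inj_eq (mulfI (lt0r_neq0 e_gt0))).
  by rewrite -(modular_eigen_support XE Xki) -(modular_eigen_support XE Xkj) eqxx.
(* Each half of the anticommutator has [N] on one side only; the identity, diagonal in every basis,
   serves as the other factor of [schur_mulmx]. *)
have one_diag l j : basis_change U 1%:M l j != 0 -> l = j.
  apply: contraNeq => lj.
  by rewrite basis_change.unlock mulmx1 mulmxV // mxE (negPf lj).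
(* As [m] depends on its indices only through [s], this also cancels [b] and [a] at indices with
   equal eigenvalues. *)
have ba i j : b i j * a i j = 1.
  by rewrite mulVf // gt_eqF // sqrtr_gt0.
rewrite linearD /=; congr (_ + _).
  rewrite -[N *m schur _ _ _]mulmx1 (schur_mulmx Uu (e := 1)).
    by rewrite scale1r mulmx1.
  move=> i k l j /sN sik /one_diag <-.
  by rewrite -(ba k l) /b /m sik.
rewrite -(mul1mx (schur U a A)) (schur_mulmx Uu (e := 1)).
  by rewrite scale1r mul1mx.
move=> i k l j /one_diag <- /sN slj.
by rewrite -(ba i l) /b /m slj.
Qed.

End Diagonal.
End Discriminate.

(** The relation turns [g * g'] into [expR (- om) * g' ^+ 2], and [g'] inherits its sign from
    [g]. *)
Lemma kms_sqrt (R : realType) (om g g' : R) :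
  0 <= g -> g = expR (- om) * g' ->
  g * (Num.sqrt (expR (- om)))^-1 = Num.sqrt (g * g').
Proof.
move=> g_ge0 gE; have e_gt0 := expR_gt0 (- om).
have g'_ge0 : 0 <= g' by move: g_ge0; rewrite gE pmulr_rge0.
rewrite gE -[in RHS]mulrA -expr2 sqrtrM ?ltW // sqrtr_sqr ger0_norm //.
rewrite -{1}[expR (- om)]sqr_sqrtr ?ltW // expr2 mulrAC mulfK //.
by rewrite gt_eqF // sqrtr_gt0.
Qed.

Theorem lemma7 (R : realType) (d : nat) (sigma : 'M[R[i]]_d)
    (L : 'M[R[i]]_d -> 'M[R[i]]_d) (I : finType)
    (w : I -> R) (G : I -> R -> R) (X : I -> R -> 'M[R[i]]_d)
    (sigma_density : density_matrix sigma)
    (sigma_full_rank : sigma \in unitmx)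
    (sigma_not_scalar : ~~ is_scalar_mx sigma)
    (L_lindblad : purely_irreversible_lindbladian L)
    (L_balanced : detailed_balanced sigma L)
    (L_canonical : lindblad_canonical_form sigma L w G X) :
  (forall f g : R -> R,
     (forall x, 0 < x -> 0 < f x) -> (forall x, 0 < x -> 0 < g x) ->
     forall A, discriminate f sigma L A = discriminate g sigma L A) /\
  (forall f : R -> R, (forall x, 0 < x -> 0 < f x) ->
     forall A, discriminate f sigma L A = A +
       \sum_a (w a)%:C *: \sum_(om <- bohr_frequencies sigma)
         ((Num.sqrt (G a om * G a (- om)))%:C *: (X a om *m A *m (X a om)^t*)
          - (G a om / 2)%:C *: anticomm ((X a om)^t* *m X a om) A)).
Proof.
(* The right side of the formula does not mention [f], so independence of [f] follows from it. *)
match goal with |- _ /\ ?P => suff Kf : P end.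
  split=> [f g f_gt0 g_gt0 A|]; last exact: Kf.
  exact: etrans (Kf f f_gt0 A) (esym (Kf g g_gt0 A)).
move=> f f_gt0 A; congr (_ + _).
have [U [s [U_unitary s_gt0 sigmaE]]] :=
  density_diag sigma_density sigma_full_rank.
rewrite (discriminate_K_schur U_unitary s_gt0 sigma_full_rank sigmaE).
rewrite (canonical_eq L_canonical) linear_sum; apply: eq_bigr => a _.
rewrite linearZ_LR linear_sum; congr (_ *: _).
(* The relations on [X] and [G] are given at Bohr frequencies, so membership is kept while summands
   are compared. *)
rewrite [LHS]big_seq [RHS]big_seq; apply: eq_bigr => om om_bohr.
have XE := canonical_X_modular L_canonical a om_bohr.
rewrite linearZ_LR /dissipator linearB linearZ_LR /=.
rewrite (schur_jump U_unitary s_gt0 sigma_full_rank sigmaE f_gt0 _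
  (expR_gt0 _) XE).
rewrite (schur_anticomm U_unitary s_gt0 sigma_full_rank sigmaE f_gt0 _
  (expR_gt0 _) XE).
rewrite scalerBr !scalerA -rmorphM /= (@kms_sqrt _ om _ (G a (- om))).
- by rewrite rmorphM fmorphV /= rmorph_nat.
- exact: (canonical_G_ge0 L_canonical).
- exact: (canonical_G_kms L_canonical).
Qed.
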